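(* There exists an infinite family $\mathcal F$ of bounded-degree planar $3$-trees such that, for any resolution rule, any $n$-vertex graph in $\mathcal F$ requires $2^{\Omega_\varepsilon(n)}$ area in any $(\frac{\pi}{3}-\varepsilon)$-Schnyder drawing, for any fixed $0<\varepsilon<\frac{\pi}{3}$.
   Context: **Planar triangulations and planar $3$-trees.** A plane graph is a planar graph equipped with a planar embedding and a designated outer face. A planar triangulation is a plane graph whose every face is bounded by a $3$-cycle. A planar $3$-tree is (in the standard sense) a planar graph obtained from a $3$-cycle by repeatedly inserting a new vertex inside a triangular face and connecting it to the three vertices of that face. ''Bounded-degree'' means that the maximum degree of all the graphs in the family is bounded by a common constant. **Drawings, area, resolution rules.** A straight-line drawing of a graph maps each vertex to a point in the plane and each edge to a straight-line segment between its end-points; it is planar if no two edges cross. The area of a drawing is, when proving lower bounds as here, the area of the smallest convex polygon enclosing the drawing. A resolution rule is any constraint implying a finite minimum area for a graph drawing. **Schnyder woods.** Let $G$ be a planar triangulation whose outer face is bounded by the $3$-cycle $(a_1,a_2,a_3)$. Let $i-1=3$ if $i=1$, and $i+1=1$ if $i=3$. A Schnyder wood $(\mathcal T_1,\mathcal T_2,\mathcal T_3)$ of $G$ is an assignment of directions and colors $1$, $2$, $3$ to the internal edges of $G$ ($\mathcal T_i$ being formed by the edges of color $i$) such that: (1) each internal vertex $v$ has one outgoing edge $e_i$ of each color $i=1,2,3$; the outgoing edges $e_1,e_2,e_3$ appear in this clockwise order at $v$; and all the incoming edges of color $i$ appear in the clockwise sector between the edges $e_{i+1}$ and $e_{i-1}$;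 (2) at the external vertex $a_i$, all the internal edges are incoming and of color $i$. **$\alpha$-Schnyder drawings.** The direction (slope) of an edge $(u,v)$ is the angle in $[0,2\pi)$ spanned by a counter-clockwise rotation around $u$ bringing a ray originating at $u$ and directed rightwards to overlap with $(u,v)$. For $0<\alpha\le\frac{\pi}{3}$, a planar straight-line drawing of a planar triangulation $G$ with Schnyder wood $(\mathcal T_1,\mathcal T_2,\mathcal T_3)$ is an $\alpha$-Schnyder drawing if, for each internal vertex $v$ of $G$, its outgoing edge in $\mathcal T_1$ has direction in $[\frac{\pi}{2}-\frac{\alpha}{2},\frac{\pi}{2}+\frac{\alpha}{2}]$, its outgoing edge in $\mathcal T_2$ has direction in $[\frac{11\pi}{6}-\frac{\alpha}{2},\frac{11\pi}{6}+\frac{\alpha}{2}]$, and its outgoing edge in $\mathcal T_3$ has direction in $[\frac{7\pi}{6}-\frac{\alpha}{2},\frac{7\pi}{6}+\frac{\alpha}{2}]$. **Asymptotic notation.** For a function $f(n)$ and a parameter $\varepsilon>0$, $f(n)\in\Omega_\varepsilon(n)$ means $f(n)\ge c_\varepsilon n$ for some constant $c_\varepsilon>0$ which only depends on $\varepsilon$.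
   Formalization: A resolution rule is taken to force area at least some δ>0 on every subgraph's drawing containing a 3-cycle (else ''area ≥ 1'' is a rule and scaling refutes the claim); the bound is δ·2^(c_ε n), since rules can be rescaled. *)

(* Defs.v *)
From HB Require Import structures.
From mathcomp Require Import all_boot all_order all_algebra.
From mathcomp Require Import all_classical all_reals all_analysis.

Set Implicit Arguments.
Unset Strict Implicit.
Unset Printing Implicit Defensive.

Import Order.TTheory GRing.Theory Num.Theory.

Local Open Scope classical_set_scope.
Local Open Scope ring_scope.

(** * Embedded graphs and planar 3-trees *)

(** A finite simple graph with a rotation system and a designated outer face.
    [cw v u] is the neighbour following [u] in the clockwise order around [v]
    (its value is irrelevant when [u] is not a neighbour of [v]).  The outer
    face is designated by a dart [(u, v)] lying on it, with the convention that
    the face of [(u, v)] is the one on the left when going from [u] to [v].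
    Planarity of the rotation system is not a field: planar 3-trees, the only
    graphs considered, are planar by construction. *)
Record emb_graph := EmbGraph {
  vert :> finType;
  adj : rel vert;
  cw : vert -> vert -> vert;
  outer : vert * vert;
  adj_sym : symmetric adj;
  adj_irr : irreflexive adj;
  cw_adj : forall v u, adj v u -> adj v (cw v u);
  cw_cycle : forall v u w, adj v u -> adj v w -> fconnect (cw v) u w;
  outer_adj : adj outer.1 outer.2
}.

Definition degree (G : emb_graph) (v : G) : nat := #|[pred u | adj v u]|.

(** The face on the left of the dart [(x, y)] continues with the dart
    [(y, cw y x)].  Hence an internal triangular face is listed in
    counterclockwise order, and the outer face in clockwise order. *)
Definition triangular_face (G : emb_graph) (x y z : G) : Prop :=
  [/\ adj x y, adj y z & adj z x] /\ [/\ cw y x = z, cw z y = x & cw x z = y].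

Definition outer_triangle (G : emb_graph) (x y z : G) : Prop :=
  triangular_face x y z /\ outer G \in [:: (x, y); (y, z); (z, x)].

(** [H] is, up to isomorphism, obtained from [G] by inserting a new vertex [t]
    inside the internal triangular face [(x, y, z)] and joining it to [x], [y]
    and [z]; around [t] the clockwise order is [x], [z], [y]. *)
Definition vertex_insertion (G H : emb_graph) : Prop :=
  exists (f : option G -> H) (x y z : G),
    let g := fun u => f (Some u) in
    let t := f None in
    [/\ bijective f,
        triangular_face x y z,
        ~ outer_triangle x y z &
        outer H = (g (outer G).1, g (outer G).2)] /\
    [/\ forall u v, adj (g u) (g v) = adj u v,
        forall u, adj t (g u) = (u \in [:: x; y; z]),
        forall v u, adj v u -> (v, u) \notin [:: (x, z); (y, x); (z, y)] ->
          cw (g v) (g u) = g (cw v u),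
        [/\ cw (g x) (g z) = t, cw (g y) (g x) = t & cw (g z) (g y) = t] &
        [/\ cw (g x) t = g y, cw (g y) t = g z & cw (g z) t = g x] /\
        [/\ cw t (g x) = g z, cw t (g z) = g y & cw t (g y) = g x]].

(** Inserting in internal faces only is no restriction: any facial triangle of
    a planar 3-tree can serve as the initial 3-cycle. *)
Inductive planar_3tree : emb_graph -> Prop :=
| planar_3tree_cycle (G : emb_graph) (x y z : G) :
    #|G| = 3 -> outer_triangle x y z -> planar_3tree G
| planar_3tree_insert (G H : emb_graph) :
    planar_3tree G -> vertex_insertion G H -> planar_3tree H.

(** * Schnyder woods *)

(** [a : 'I_3 -> G] lists the outer 3-cycle; colours 1, 2, 3 are 0, 1, 2. *)
Definition internal_vertex (G : emb_graph) (a : 'I_3 -> G) (v : G) : bool :=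
  v \notin codom a.

Definition internal_edge (G : emb_graph) (a : 'I_3 -> G) (u v : G) : bool :=
  adj u v && (internal_vertex a u || internal_vertex a v).

(** Turning clockwise around [v] from [x], one meets [y] strictly before
    meeting [z]. *)
Definition cw_between (G : emb_graph) (v x y z : G) : bool :=
  (0 < findex (cw v) x y < findex (cw v) x z)%N.

(** [T i u v] means that [uv] is an internal edge directed from [u] to [v] and
    coloured [i]; [ordS] and [ord_pred] are the cyclic successor and
    predecessor of a colour. *)
Record schnyder_wood (G : emb_graph) (a : 'I_3 -> G) (T : 'I_3 -> rel G) : Prop :=
  SchnyderWood {
  sw_outer_cycle : exists x y z : G,
    outer_triangle x y z /\ forall i, a i = nth x [:: x; y; z] i;
  sw_internal : forall i u v, T i u v -> internal_edge a u v;
  sw_assigned : forall u v, internal_edge a u v ->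
    exists i, T i u v \/ T i v u;
  sw_color_uniq : forall i j u v, T i u v -> T j u v -> i = j;
  sw_dir_uniq : forall i j u v, T i u v -> ~~ T j v u;
  sw_out : forall v, internal_vertex a v -> forall i, exists! w, T i v w;
  sw_out_order : forall v, internal_vertex a v -> forall i x y z,
    T i v x -> T (ordS i) v y -> T (ord_pred i) v z -> cw_between v x y z;
  sw_in_sector : forall v, internal_vertex a v -> forall i u x y,
    T i u v -> T (ordS i) v x -> T (ord_pred i) v y -> cw_between v x u y;
  sw_external : forall i u, internal_edge a u (a i) -> T i u (a i)
}.

(** * Straight-line drawings *)

Section Drawings.
Context {R : realType}.
Implicit Types p q : R * R.

Definition segment p q : set (R * R) :=
  [set s | exists2 t : R, 0 <= t <= 1 &
    s = ((1 - t) * p.1 + t * q.1, (1 - t) * p.2 + t * q.2)].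

Definition planar_drawing (V : finType) (e : rel V) (pos : V -> R * R) : Prop :=
  injective pos /\
  forall u v x y, e u v -> e x y -> (x, y) \notin [:: (u, v); (v, u)] ->
    forall s, segment (pos u) (pos v) s -> segment (pos x) (pos y) s ->
    exists w, [/\ w \in [:: u; v], w \in [:: x; y] & s = pos w].

(** Convex hull of the points [pos v], [v \in A]; for [A] the set of all
    vertices this is the smallest convex polygon enclosing the drawing. *)
Definition hull (V : finType) (pos : V -> R * R) (A : {set V}) : set (R * R) :=
  [set s | exists l : V -> R,
    [/\ forall v, 0 <= l v, \sum_(v in A) l v = 1 &
        s = (\sum_(v in A) l v * (pos v).1, \sum_(v in A) l v * (pos v).2)]].

Definition area (V : finType) (pos : V -> R * R) (A : {set V}) : \bar R :=
  (@lebesgue_measure R \x @lebesgue_measure R)%E (hull pos A).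

Definition direction p q (theta : R) : Prop :=
  0 <= theta < 2 * pi /\
  exists2 r : R, 0 < r & q = (p.1 + r * cos theta, p.2 + r * sin theta).

Definition central_direction (i : 'I_3) : R :=
  nth 0 [:: pi / 2; 11 * pi / 6; 7 * pi / 6] i.

(** The embedding and outer face of [G] need not be mentioned: the
    direction constraints make every internal vertex interior to the
    convex hull, and force the order of its outgoing edges, so that a drawing
    satisfying these conditions realises the embedding of a triangulation. *)
Definition schnyder_drawing (alpha : R) (G : emb_graph) (a : 'I_3 -> G)
    (T : 'I_3 -> rel G) (pos : G -> R * R) : Prop :=
  planar_drawing (@adj G) pos /\
  forall v w i, internal_vertex a v -> T i v w ->
    exists2 theta, direction (pos v) (pos w) theta &
      central_direction i - alpha / 2 <= theta <=
      central_direction i + alpha / 2.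

(** A constraint on straight-line drawings of graphs is a resolution rule with
    minimum area [delta] if, in each planar drawing obeying it, the drawing of
    each subgraph occupies area at least [delta].  Only subgraphs containing a
    3-cycle are considered, since others (e.g. paths) may have a drawing of
    zero area under any of the usual rules.  A bound on the whole drawing alone
    would make "the area is at least 1" a rule, which every drawing satisfies
    after scaling. *)
Definition resolution_rule
    (P : forall V : finType, rel V -> (V -> R * R) -> Prop) (delta : R) : Prop :=
  0 < delta /\
  forall (V : finType) (e : rel V) (pos : V -> R * R),
    planar_drawing e pos -> P V e pos ->
  forall (A : {set V}) x y z, x \in A -> y \in A -> z \in A ->
    e x y -> e y z -> e z x -> (delta%:E <= area pos A)%E.

End Drawings.

(* Main.v *)
Require Import Defs.
From mathcomp Require Import all_boot all_order all_algebra.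
From mathcomp Require Import all_classical all_reals all_analysis.
From mathcomp Require Import measurable_realfun zify ring lra.

(** The vertices of the graph are 0, 1, ..., n - 1, and each k >= 3 is inserted
    in the triangle (k - 3, k - 2, k - 1).  Counting outgoing edges from the last
    vertex downwards shows that, in every Schnyder wood, k points to k - 3, k - 2
    and k - 1; the rotation at k - 1 and at k then forces the colour of an edge
    to be the residue mod 3 of its head, up to a shift.  Put s = sin eps.  Unit
    vectors in the cones of two different colours have a cross product of
    absolute value at least s.  If t, of out-neighbours A, B, C, lies in the
    triangle ABC and B points to A with the colour of tA, then the law of sines in
    ABt gives |tA| >= s |tB|, so the triangle tAC has area at least s^2 times that
    of tBC, and replacing A by t divides the area by at least 1 + s^2.  The
    resolution rule bounds the area of the innermost triangle from below. *)

Set Implicit Arguments.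
Unset Strict Implicit.
Unset Printing Implicit Defensive.

Import Order.TTheory GRing.Theory Num.Theory.

(** * The cube of a path as an embedded planar 3-tree *)

Definition near3 (i j : nat) : bool := [&& i != j, i <= j + 3 & j <= i + 3].

(** Clockwise around [k], the neighbours are [k - 3], [k - 2], [k + 1], [k + 3],
    [k + 2], [k - 1], where those outside [0, n) are skipped.  The last branch
    makes the map injective on all vertices. *)
Definition cw_nat (n k u : nat) : nat :=
  if u + 3 == k then u.+1
  else if u + 2 == k then (if k.+1 < n then k.+1 else k.-1)
  else if u == k.+1 then
    (if k + 3 < n then k + 3 else if k + 2 < n then k + 2 else k.-1)
  else if u == k + 3 then k + 2
  else if u == k + 2 then (if k == 0 then 1 else k.-1)
  else if u.+1 == k then (if 3 <= k then k - 3 else if k == 2 then 0 else 2)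
  else u.

Ltac case_ifs := rewrite /cw_nat /near3; repeat case: ifP; lia.

Lemma cw_nat_ltn n k u : 2 < n -> k < n -> u < n -> cw_nat n k u < n.
Proof. case_ifs. Qed.

Lemma cw_nat_near3 n k u : 2 < n -> k < n -> u < n -> near3 k u -> near3 k (cw_nat n k u).
Proof. case_ifs. Qed.

Lemma cw_nat_inj n k u w : 2 < n -> k < n -> u < n -> w < n ->
  cw_nat n k u = cw_nat n k w -> u = w.
Proof. case_ifs. Qed.

(* Decreases along [cw_nat] until the hub [k - 1] (or [2] if [k = 0]) is met. *)
Definition cw_rank (k u : nat) : nat :=
  if u.+1 == k then 0 else if u == k + 2 then 1 else if u == k + 3 then 2
  else if u == k.+1 then 3 else if u + 2 == k then 4 else 5.

Lemma cw_rank_ltn n k u : 2 < n -> k < n -> u < n -> near3 k u ->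
  u != (if k == 0 then 2 else k.-1) -> cw_rank k (cw_nat n k u) < cw_rank k u.
Proof. rewrite /cw_rank; case_ifs. Qed.

Section Graph.
Variable m : nat.
Local Notation vertex := 'I_m.+3.

Definition strip_adj : rel vertex := fun u v => near3 u v.

Definition strip_cw (v u : vertex) : vertex := inord (cw_nat m.+3 v u).

Lemma val_strip_cw v u : strip_cw v u = cw_nat m.+3 v u :> nat.
Proof. by rewrite inordK// cw_nat_ltn. Qed.

Lemma strip_adj_sym : symmetric strip_adj.
Proof. by move=> u v; rewrite /strip_adj /near3; lia. Qed.

Lemma strip_adj_irr : irreflexive strip_adj.
Proof. by move=> u; rewrite /strip_adj /near3; lia. Qed.

Lemma strip_cw_adj (v u : vertex) : strip_adj v u -> strip_adj v (strip_cw v u).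
Proof. by rewrite /strip_adj val_strip_cw; exact: cw_nat_near3. Qed.

Lemma strip_cw_inj (v : vertex) : injective (strip_cw v).
Proof.
move=> u w /(congr1 val); rewrite /= !val_strip_cw => E.
by apply/val_inj; apply: cw_nat_inj E.
Qed.

(** Since [cw_rank] drops at each step, the rotation leads every neighbour of [v] to the hub [h].
    Injectivity makes [fconnect] symmetric, so two neighbours are joined through the hub. *)
Lemma strip_cw_cycle (v u w : vertex) :
  strip_adj v u -> strip_adj v w -> fconnect (strip_cw v) u w.
Proof.
pose h : vertex := inord (if v == 0 :> nat then 2 else v.-1).
have hE : h = (if v == 0 :> nat then 2 else v.-1) :> nat.
  by rewrite inordK//; case: ifP; have := ltn_ord v; lia.
suff H x : strip_adj v x -> fconnect (strip_cw v) x h.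
  move=> /H uh /H; rewrite (fconnect_sym (@strip_cw_inj v)).
  exact: connect_trans.
have [r] := ubnP (cw_rank v x); elim: r x => // r IH x xr vx.
have [->|xh] := eqVneq x h; first exact: connect0.
apply: connect_trans (fconnect1 _ x) _; apply: IH; last exact: strip_cw_adj.
apply: (@leq_trans (cw_rank v x)) => //; rewrite val_strip_cw; apply: cw_rank_ltn => //.
by rewrite -hE.
Qed.

Definition strip_outer : vertex * vertex := (ord0, inord 1).

Lemma strip_outer_adj : strip_adj strip_outer.1 strip_outer.2.
Proof. by rewrite /strip_adj /= inordK. Qed.

Definition strip : emb_graph := EmbGraph strip_adj_sym strip_adj_irr
  strip_cw_adj strip_cw_cycle strip_outer_adj.

Lemma strip_degree (v : strip) : degree v <= 7.
Proof.
(* Neighbours lie in the window from [v - 3] to [v + 3], which [f] numbers from 0 to 6; for them the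
   subtraction is not truncated. *)
pose f (u : vertex) : 'I_7 := inord (u + 3 - v).
rewrite /degree -[7]card_ord -(@card_in_imset _ _ f [pred u | adj v u]) ?max_card//.
move=> u w; rewrite !inE /adj /= /strip_adj /near3 => vu vw.
move=> /(congr1 val); rewrite /= !inordK; last 2 first; first by lia.
  by lia.
by move=> E; apply/val_inj => /=; lia.
Qed.
End Graph.

Lemma strip_triangular_face m (x y z : strip m) :
  strip_adj x y -> strip_adj y z -> strip_adj z x ->
  cw_nat m.+3 y x = z -> cw_nat m.+3 z y = x -> cw_nat m.+3 x z = y ->
  triangular_face x y z.
Proof.
by move=> xy yz zx Ez Ex Ey; split; split => //;
  apply/val_inj; rewrite /cw /= val_strip_cw.
Qed.

(** The excluded darts are the corners of the face [(m, m + 2, m + 1)], where the vertex [m + 3]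
    enters the rotation. *)
Lemma cw_nat_insert m v u : v < m.+3 -> u < m.+3 -> near3 v u ->
  ~~ [|| (v == m) && (u == m.+1), (v == m.+2) && (u == m) | (v == m.+1) && (u == m.+2)] ->
  cw_nat m.+4 v u = cw_nat m.+3 v u.
Proof. case_ifs. Qed.

Lemma strip_planar_3tree m : planar_3tree (strip m).
Proof.
elim: m => [|m IHm].
  pose v k : strip 0 := inord k.
  apply: (@planar_3tree_cycle _ (v 0) (v 1) (v 2)); first by rewrite card_ord.
  split; last first.
    by rewrite !inE /outer /=; apply/orP; left; apply/eqP; congr pair; apply/val_inj;
      rewrite /= inordK.
  by apply: strip_triangular_face; rewrite /strip_adj !inordK.
apply: planar_3tree_insert IHm _.
pose f (o : option (strip m)) : strip m.+1 :=
  if o is Some u then inord u else ord_max.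
have fE u : f (Some u) = u :> nat by rewrite /f inordK// ltnS ltnW.
have fN : f None = m.+3 :> nat by [].
pose w k : strip m := inord k.
have w0 : w m = m :> nat by rewrite inordK// ltnW.
have w1 : w m.+1 = m.+1 :> nat by rewrite inordK.
have w2 : w m.+2 = m.+2 :> nat by rewrite inordK.
(* Internal faces are listed counterclockwise, hence this order; for [m = 0] it is the inner side of
   the initial triangle. *)
exists f, (w m), (w m.+2), (w m.+1) => g t.
have gE u : g u = u :> nat by exact: fE.
have tE : t = m.+3 :> nat by [].
have cwE (u v : strip m.+1) : cw u v = cw_nat m.+4 u v :> nat by exact: val_strip_cw.
have cwE' (u v : strip m) : cw u v = cw_nat m.+3 u v :> nat by exact: val_strip_cw.
split; split.
- apply: inj_card_bij; last by rewrite card_option !card_ord.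
  move=> [u|] [v|] // /(congr1 (@nat_of_ord _)); rewrite ?fE ?fN => E.
  + by congr Some; apply/val_inj.
  + by have := ltn_ord u; rewrite E ltnn.
  + by have := ltn_ord v; rewrite -E ltnn.
- by apply: strip_triangular_face; rewrite /strip_adj ?w0 ?w1 ?w2; case_ifs.
- case=> _; rewrite !inE /outer /= /strip_outer !xpair_eqE -!val_eqE /= w0 w1 w2.
  by rewrite inordK//; lia.
- by congr pair; apply/val_inj; rewrite /= ?gE ?inordK.
- by move=> u v; rewrite /adj /= /strip_adj !gE.
- move=> u; rewrite /adj /= /strip_adj tE gE !inE -!val_eqE /= ?w0 ?w1 ?w2.
  by have := ltn_ord u; rewrite /near3; lia.
- move=> v u; rewrite /adj /= /strip_adj !inE !xpair_eqE -!val_eqE /= ?w0 ?w1 ?w2.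
  move=> vu H; apply/val_inj; rewrite /= cwE !gE cwE'.
  by apply: cw_nat_insert => //; move: H; rewrite w0 w1 w2.
- by split; apply/val_inj; rewrite /= cwE ?tE ?gE ?w0 ?w1 ?w2; case_ifs.
- split; first by split; apply/val_inj; rewrite /= cwE ?tE ?gE ?w0 ?w1 ?w2; case_ifs.
  by split; apply/val_inj; rewrite /= cwE ?tE ?gE ?w0 ?w1 ?w2; case_ifs.
Qed.

(** * Its Schnyder woods *)

(** The index of [z] counted from [x] is at most 1, which leaves no room for [y]. This turns
    consecutive neighbours into contradictions with the order conditions of a wood. *)
Lemma cw_betweenN (G : emb_graph) (v x y z : G) : cw v x = z -> ~~ cw_between v x y z.
Proof.
move=> <-; rewrite /cw_between; apply/negP => /andP[y0 yz].
suff : findex (cw v) x (cw v x) <= 1 by lia.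
rewrite /findex /orbit -orderSpred /=; case: eqP => // _.
by case: (order _ _).-1 => //= k; rewrite eqxx.
Qed.

Lemma ordS_ord_pred3 (i : 'I_3) : ordS (ordS i) = ord_pred i.
Proof. by apply/val_inj; case: i => [[|[|[|//]]] Hi]. Qed.

Lemma ord_pred_ordS3 (i : 'I_3) : ord_pred (ordS i) = i.
Proof. by apply/val_inj; case: i => [[|[|[|//]]] Hi]. Qed.

Lemma ordS_cases (i j : 'I_3) : [\/ j = i, j = ordS i | j = ordS (ordS i)].
Proof.
case: i j => [[|[|[|//]]] Hi] [[|[|[|//]]] Hj];
  by [apply: Or31; apply/val_inj|apply: Or32; apply/val_inj|apply: Or33; apply/val_inj].
Qed.

Section Wood.
Variable m : nat.
Local Notation G := (strip m).
Local Notation n := m.+3.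
Variables (a : 'I_3 -> G) (T : 'I_3 -> rel G).
Hypothesis wood : schnyder_wood a T.

Definition strip_vertex (k : nat) : G := inord k.
Local Notation v := strip_vertex.

Lemma strip_vertexE k : k < n -> v k = k :> nat.
Proof. exact: inordK. Qed.

Lemma strip_vertexK (u : G) : v u = u.
Proof. exact: inord_val. Qed.

Lemma cw_strip_vertex k u w : k < n -> u < n -> cw_nat n k u = w -> cw (v k) (v u) = v w.
Proof.
move=> kn un <-; apply/val_inj; rewrite /cw /= val_strip_cw !strip_vertexE//.
exact: cw_nat_ltn.
Qed.

Lemma cw_strip_last p : p.+3 < n -> cw (v p.+3) (v p.+2) = v p.
Proof.
move=> pn; apply: cw_strip_vertex => //; first exact: ltnW.
by case_ifs.
Qed.

Lemma cw_strip_first p : p.+3 < n -> cw (v p.+3) (v p) = v p.+1.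
Proof.
move=> pn; apply: cw_strip_vertex => //; first lia.
by case_ifs.
Qed.

(** The list [a] may start at any dart of the outer face; [c] absorbs this cyclic shift. *)
Lemma outer_color : exists c : 'I_3, (forall i, a i < 3) /\
  forall j, j < 3 -> a (iter j (@ordS 3) c) = v j.
Proof.
have [[x [y [z [[[adjs [cyx czy cxz]] out] aE]]]] _ _ _ _ _ _ _ _] := wood.
have c12 : cw (v 1) (v 0) = v 2 by exact: cw_strip_vertex.
have v0 : v 0 = 0 :> nat by rewrite strip_vertexE.
have v1 : v 1 = 1 :> nat by rewrite strip_vertexE.
have v2 : v 2 = 2 :> nat by rewrite strip_vertexE.
have o0 : outer G = (v 0, v 1) by congr pair; apply/ord_inj; rewrite v0.
suff [c H] : exists c, forall j, j < 3 -> a (iter j (@ordS 3) c) = v j.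
  exists c; split => // i; have [->|->|->] := ordS_cases c i.
  - by rewrite (H 0)// v0.
  - by rewrite (H 1)// v1.
  - by rewrite (H 2)// v2.
move: out; rewrite o0 !inE !xpair_eqE => /or3P[] /andP[/eqP E1 /eqP E2].
- exists ord0 => -[|[|[|//]]] _; rewrite aE//=.
  by rewrite -cyx -E1 -E2.
- exists (inord 1) => -[|[|[|//]]] _; rewrite aE /= inordK//=.
  by rewrite -czy -E1 -E2.
- exists (inord 2) => -[|[|[|//]]] _; rewrite aE /= inordK//=.
  by rewrite -cxz -E1 -E2.
Qed.

Lemma internal_strip (u : G) : internal_vertex a u = (3 <= u).
Proof.
have [c [a3 ac]] := outer_color.
apply/idP/idP; rewrite /internal_vertex.
  apply: contraR; rewrite -ltnNge => u3; apply/codomP.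
  by exists (iter u (@ordS 3) c); rewrite ac// strip_vertexK.
by move=> u3; apply/negP => /codomP[i E]; have := a3 i; rewrite -E ltnNge u3.
Qed.

(** Induction from the last vertex downwards: a neighbour [w > k] already has its edge directed to
    [k], so the three outgoing edges of [k] can only go to [k - 1], [k - 2] and [k - 3]. *)
Lemma wood_out (k j : nat) : 3 <= k < n -> j < k <= j + 3 -> exists i, T i (v k) (v j).
Proof.
have [s] := ubnP (n - k); elim: s k j => // s IH k j nks /andP[k3 kn] jk.
have vk : v k = k :> nat by exact: strip_vertexE.
have kint : internal_vertex a (v k) by rewrite internal_strip vk.
have out i : exists w : G, T i (v k) w by have [w [Tw _]] := sw_out wood kint i; exists w.
have {}out i : exists o : 'I_3, T i (v k) (v (k.-1 - o)).
  have [w Tw] := out i.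
  have : internal_edge a (v k) w by exact: (sw_internal wood Tw).
  move=> /andP[]; rewrite /adj /= /strip_adj vk => kw _.
  have [wk|kw'] := ltnP w k.
    exists (inord (k.-1 - w)); rewrite inordK; last by move: kw; rewrite /near3; lia.
    by rewrite subKn ?strip_vertexK//; lia.
  have [] := IH w k; [|have := ltn_ord w| |]; try by move: kw; rewrite /near3; lia.
  move=> i' Ti'; rewrite strip_vertexK in Ti'.
  by have := sw_dir_uniq wood i' Tw; rewrite Ti'.
(* [f] maps a colour to the offset of its head below [k - 1]. An edge has one colour, so [f] is
   injective on ['I_3], hence onto. *)
have {out}[f fP] := fin_all_exists out.
have fI : injective f.
  by move=> i i' E; apply: (sw_color_uniq wood (fP i)); rewrite E.
have jn : k.-1 - j < 3 by lia.
exists (invF fI (Ordinal jn)); have := fP (invF fI (Ordinal jn)).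
by rewrite f_invF /= subKn//; lia.
Qed.

Lemma wood_color : exists c : nat -> 'I_3, (forall j, c j.+1 = ordS (c j)) /\
  forall k j, 3 <= k < n -> j < k <= j + 3 -> T (c j) (v k) (v j).
Proof.
have [c0 [_ ac]] := outer_color.
pose c j := iter j (@ordS 3) c0; exists c; split => //.
have c3 j : c j.+3 = c j.
  by rewrite /c /=; apply/val_inj; case: (iter j _ _) => [[|[|[|//]]] Hi].
(* Base case: the edges of vertex 3 end at the outer vertices, which dictate their colours. *)
elim=> // k IH j; have [->|k2] := eqVneq k 2.
  move=> /andP[_ n3] /andP[j3 _]; rewrite -(ac _ j3); apply: (sw_external wood).
  rewrite /internal_edge !internal_strip (ac _ j3) /adj /= /strip_adj.
  by rewrite !strip_vertexE ?(ltn_trans j3)//; rewrite /near3; lia.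
move=> /andP[k3 kn].
have {}k3 : 3 <= k by lia.
have kn' : k < n by lia.
have uniq_out i x y : x < n -> y < n -> T i (v k.+1) (v x) -> T i (v k.+1) (v y) -> x = y.
  move=> xn yn Tx Ty.
  have kint : internal_vertex a (v k.+1) by rewrite internal_strip strip_vertexE//; lia.
  have [w [_ wU]] := sw_out wood kint i.
  by rewrite -(strip_vertexE xn) -(strip_vertexE yn) -(wU _ Tx) (wU _ Ty).
have {}IH x : x < k <= x + 3 -> T (c x) (v k) (v x) by move=> xk; apply: IH => //; lia.
have [p kE] : exists p, k = p.+3 by exists (k - 3); lia.
rewrite {k2 k3}kE in kn kn' uniq_out IH *.
have p2n : p.+2 < n by exact: ltnW.
have p1n : p.+1 < n by exact: ltnW.
have kint : internal_vertex a (v p.+3) by rewrite internal_strip strip_vertexE.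
have kint' : internal_vertex a (v p.+4) by rewrite internal_strip strip_vertexE.
have [i Ti] : exists i, T i (v p.+4) (v p.+3) by apply: wood_out; lia.
have [i2 T2] : exists i, T i (v p.+4) (v p.+2) by apply: wood_out; lia.
have [i1 T1] : exists i, T i (v p.+4) (v p.+1) by apply: wood_out; lia.
have T3p : T (c p) (v p.+3) (v p) by apply: IH; lia.
have T3p1 : T (c p.+1) (v p.+3) (v p.+1) by apply: IH; lia.
have T3p2 : T (c p.+2) (v p.+3) (v p.+2) by apply: IH; lia.
(* Clockwise around [p + 3], the vertices [p + 2], [p], [p + 1] are consecutive, so the incoming
   edge from [p + 4] fits only in the sector from [p + 1] to [p + 2], that of colour [c p]. *)
have ip : i = c p.
  have [//|E|E] := ordS_cases (c p) i.
  - have := @sw_in_sector _ _ _ wood _ kint i (v p.+4) (v p.+2) (v p) Ti.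
    rewrite E ord_pred_ordS3 => /(_ T3p2 T3p) H.
    by have := cw_betweenN (v p.+4) (cw_strip_last kn'); rewrite H.
  - have := @sw_in_sector _ _ _ wood _ kint i (v p.+4) (v p) (v p.+1) Ti.
    rewrite E ord_pred_ordS3 -[ordS _]/(c p.+3) c3 => /(_ T3p T3p1) H.
    by have := cw_betweenN (v p.+4) (cw_strip_first kn'); rewrite H.
rewrite {i}ip in Ti.
have ne12 : i1 <> i2.
  move=> E; have := uniq_out i2 p.+1 p.+2 p1n p2n.
  by rewrite -{1}E => /(_ T1 T2); clear; lia.
have ne1 : i1 <> c p.
  move=> E; have := uniq_out (c p) p.+1 p.+3 p1n kn'.
  by rewrite -{1}E => /(_ T1 Ti); clear; lia.
have ne2 : i2 <> c p.
  move=> E; have := uniq_out (c p) p.+2 p.+3 p2n kn'.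
  by rewrite -{1}E => /(_ T2 Ti); clear; lia.
(* Two colours remain for the heads [p + 1] and [p + 2]. Exchanging them would put [p + 2] between
   [p + 3] and [p + 1], which are consecutive around [p + 4]. *)
have e1 : i1 = c p.+1.
  have [//|//|E1] := ordS_cases (c p) i1.
  have [//|E2|E2] := ordS_cases (c p) i2; last by rewrite E1 E2 in ne12.
  rewrite ordS_ord_pred3 in E1; rewrite E1 in T1; rewrite E2 in T2.
  have H := @sw_out_order _ _ _ wood _ kint' (c p) (v p.+3) (v p.+2) (v p.+1) Ti T2 T1.
  by have := cw_betweenN (v p.+2) (cw_strip_last kn); rewrite H.
have e2 : i2 = c p.+2.
  by have [//|E2|//] := ordS_cases (c p) i2; rewrite e1 E2 in ne12.
rewrite e1 in T1; rewrite e2 in T2.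
move=> jp; have [->|->|->] : [\/ j = p.+1, j = p.+2 | j = p.+3].
  have [->|[->|->]] : j = p.+1 \/ (j = p.+2 \/ j = p.+3) by move: jp; clear; lia.
  - exact: Or31.
  - exact: Or32.
  - exact: Or33.
- exact: T1.
- exact: T2.
- by rewrite c3.
Qed.

End Wood.

Local Open Scope ring_scope.

(** * Area of triangles *)

Section Area.
Local Open Scope classical_set_scope.
Context {R : realType}.
Notation mR := (measurableTypeR R).
Notation leb := (@lebesgue_measure R).
Notation plane := (@lebesgue_measure R \x @lebesgue_measure R)%E.
Implicit Types (a b c : R) (p q r : R * R).

(** * Planar Lebesgue measure under affine maps *)

Lemma measurable_affine a b : measurable_fun [set: mR] ((fun y => a * y + b) : mR -> mR).
Proof.
exact: measurable_funD.
Qed.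

(** The right-hand side is a scaled pushforward measure; it agrees with Lebesgue measure on
    half-open intervals, hence everywhere by uniqueness. *)
Lemma lebesgue_measure_affine a b (A : set mR) : a != 0 -> measurable A ->
  leb A = (`|a|%:E * leb [set y : mR | A (a * y + b)%R])%E.
Proof.
move=> a0 mA.
pose k : {nonneg R} := NngNum (normr_ge0 a).
have mf := measurable_affine a b.
pose m : {measure set mR -> \bar R} :=
  mscale k (measure_function_pushforward__canonical__measure_function_Measure leb mf).
have mE B : m B = (`|a|%:E * leb [set y : mR | B (a * y + b)%R])%E by [].
rewrite -mE; apply: lebesgue_measure_unique mA => X [[x y] /= _ <-]; rewrite mE.
have [a_gt0|a_lt0|/eqP] := ltrgt0P a; last by rewrite (negbTE a0).
  have -> : [set z | (`]x, y]%classic : set R) (a * z + b)] = `](x - b) / a, (y - b) / a]%classic.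
    apply/seteqP; split => z /=; rewrite !in_itv/= ltr_pdivrMr// ler_pdivlMr//;
      by rewrite ltrBlDr lerBrDr [z * a]mulrC.
  rewrite !lebesgue_measure_itv/= !lte_fin ltr_pM2r ?invr_gt0// ltrD2r.
  case: ifP => _; last by rewrite mule0.
  by rewrite -!EFinD -EFinM; congr (_%:E); field.
have -> : [set z | (`]x, y]%classic : set R) (a * z + b)] = `[(y - b) / a, (x - b) / a[%classic.
  apply/seteqP; split => z /=; rewrite !in_itv/= ler_ndivrMr// ltr_ndivlMr//;
    by rewrite ltrBlDr lerBrDr [z * a]mulrC andbC.
rewrite !lebesgue_measure_itv/= !lte_fin ltr_nM2r ?invr_lt0// ltrD2r.
case: ifP => _; last by rewrite mule0.
by rewrite -!EFinD -EFinM; congr (_%:E); field.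
Qed.

Lemma xsection_setE (A : set (mR * mR)) x : xsection A x = [set y : mR | A (x, y)].
Proof. by apply/seteqP; split => y; rewrite /xsection/= inE. Qed.

Lemma ysection_setE (A : set (mR * mR)) y : ysection A y = [set x : mR | A (x, y)].
Proof. by apply/seteqP; split => x; rewrite /ysection/= inE. Qed.

Definition plane_area (A : set (mR * mR)) : \bar R := plane A.

Lemma plane_area_xE A : plane_area A = (\int[leb]_x leb [set y : mR | A (x, y)])%E.
Proof. by apply: eq_integral => x _ /=; rewrite xsection_setE. Qed.

Lemma plane_area_yE A : measurable A ->
  plane_area A = (\int[leb]_y leb [set x : mR | A (x, y)])%E.
Proof.
move=> mA; rewrite /plane_area.
rewrite (@product_measure_unique _ _ _ _ _ leb leb (leb \x^ leb)%E)//; last first.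
  exact: product_measure2E.
by apply: eq_integral => y _ /=; rewrite ysection_setE.
Qed.

(** Section measures come from an outer measure, and the integral is a supremum over simple
    functions below the integrand; both are monotone. Here [B] will be the hull of a whole
    drawing. *)
Lemma le_plane_area A B : measurable A -> A `<=` B -> (plane_area A <= plane_area B)%E.
Proof.
move=> mA AB; rewrite !plane_area_xE !ge0_integralTE//.
apply: le_ereal_sup => _ [h hA <-]; exists h => // x.
apply: (le_trans (hA x)); rewrite /lebesgue_measure/lebesgue_stieltjes_measure.
by apply: le_mu_ext => y /=; exact: AB.
Qed.

Lemma measurable_plane_affine a b c :
  measurable_fun [set: mR * mR] ((fun p => a * p.1 + (b * p.2 + c)) : _ -> mR).
Proof.
apply: measurable_funD; first exact: measurable_funM.
by apply: measurable_funD => //; exact: measurable_funM.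
Qed.

Lemma measurable_comp_affine_y a b c A : measurable A ->
  measurable [set p : mR * mR | A (p.1, b * p.1 + (a * p.2 + c))%R].
Proof.
move=> mA; rewrite -[X in measurable X]setTI.
apply: (@measurable_fun_pair _ _ _ _ _ _ fst
  (fun p : mR * mR => b * p.1 + (a * p.2 + c))) => //.
exact: measurable_plane_affine.
Qed.

Lemma measurable_comp_affine_x a b c A : measurable A ->
  measurable [set p : mR * mR | A (a * p.1 + (b * p.2 + c), p.2)%R].
Proof.
move=> mA; rewrite -[X in measurable X]setTI.
apply: (@measurable_fun_pair _ _ _ _ _ _
  (fun p : mR * mR => a * p.1 + (b * p.2 + c)) snd) => //.
exact: measurable_plane_affine.
Qed.

Lemma plane_area_affine_y a b c A : a != 0 -> measurable A ->
  plane_area A =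
  (`|a|%:E * plane_area [set p : mR * mR | A (p.1, b * p.1 + (a * p.2 + c))%R])%E.
Proof.
move=> a0 mA; rewrite !plane_area_xE -ge0_integralZl//=.
- apply: eq_integral => x _.
  rewrite (@lebesgue_measure_affine a (b * x + c))//=; last first.
    by rewrite -xsection_setE; exact: measurable_xsection.
  by under [in RHS]eq_set do rewrite addrCA.
- have := measurable_fun_xsection leb (measurable_comp_affine_y a b c mA).
  by congr measurable_fun; apply/funext => x /=; rewrite xsection_setE.
Qed.

Lemma plane_area_affine_x a b c A : a != 0 -> measurable A ->
  plane_area A =
  (`|a|%:E * plane_area [set p : mR * mR | A (a * p.1 + (b * p.2 + c), p.2)%R])%E.
Proof.
move=> a0 mA; have mA' := measurable_comp_affine_x a b c mA.
rewrite !plane_area_yE// -ge0_integralZl//=.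
- apply: eq_integral => y _.
  rewrite (@lebesgue_measure_affine a (b * y + c))//=.
  by rewrite -ysection_setE; exact: measurable_ysection.
- have := measurable_fun_ysection leb mA'.
  by congr measurable_fun; apply/funext => y /=; rewrite ysection_setE.
Qed.

(** * Triangles, signed areas and hulls *)

Definition orient p q r : R :=
  (q.1 - p.1) * (r.2 - p.2) - (q.2 - p.2) * (r.1 - p.1).

Definition triangle p q r : set (mR * mR) :=
  [set s | exists a b c, [/\ 0 <= a, 0 <= b, 0 <= c, a + b + c = 1 &
    s = (a * p.1 + b * q.1 + c * r.1, a * p.2 + b * q.2 + c * r.2)]].

Definition unit_triangle : set (mR * mR) :=
  [set s | [/\ 0 <= s.1, 0 <= s.2 & s.1 + s.2 <= 1]].

Lemma measurable_unit_triangle : measurable unit_triangle.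
Proof.
have mle (f g : mR * mR -> mR) : measurable_fun setT f -> measurable_fun setT g ->
    measurable [set s | f s <= g s].
  by move=> mf mg; rewrite -[X in measurable X]setTI; exact: measurable_fun_le.
have -> : unit_triangle = [set s : mR * mR | 0 <= s.1 :> R] `&`
    [set s : mR * mR | 0 <= s.2 :> R] `&` [set s : mR * mR | s.1 + s.2 <= 1 :> R].
  by apply/seteqP; split => s /= => [[]|[[]]].
apply: measurableI; last by apply: mle => //; exact: measurable_funD.
by apply: measurableI; apply: mle.
Qed.

(** By Cramer's rule, the two quotients are the barycentric coordinates of [s] at [q] and [r]. *)
Lemma triangleE p q r : orient p q r != 0 ->
  triangle p q r = [set s : mR * mR | unit_triangle
    ((orient p s r / orient p q r)%R, (orient p q s / orient p q r)%R)].
Proof.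
move=> D0; apply/seteqP; split => s /=.
  move=> [a [b [c [a0 b0 c0 abc ->]]]]; have -> : a = 1 - b - c by lra.
  have E1 : orient p ((1 - b - c) * p.1 + b * q.1 + c * r.1,
      (1 - b - c) * p.2 + b * q.2 + c * r.2) r = b * orient p q r.
    by rewrite /orient/=; ring.
  have E2 : orient p q ((1 - b - c) * p.1 + b * q.1 + c * r.1,
      (1 - b - c) * p.2 + b * q.2 + c * r.2) = c * orient p q r.
    by rewrite /orient/=; ring.
  by rewrite E1 E2 !mulfK//; split => /=; lra.
case=> /= b0 c0 bc.
exists (1 - orient p s r / orient p q r - orient p q s / orient p q r),
  (orient p s r / orient p q r), (orient p q s / orient p q r).
split => //; [lra|lra|].
by case: s b0 c0 bc D0 => s1 s2 _ _ _; rewrite /orient/= => D0; congr pair; field.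
Qed.

Lemma triangle_swap p q r : triangle p q r = triangle p r q.
Proof.
by apply/seteqP; split => s [a [b [c [a0 b0 c0 abc ->]]]]; exists a, c, b;
  split => //; [lra|congr pair; ring|lra|congr pair; ring].
Qed.

Lemma orient_swap p q r : orient p r q = - orient p q r.
Proof. by rewrite /orient; ring. Qed.

Lemma measurable_triangle p q r : orient p q r != 0 -> measurable (triangle p q r).
Proof.
move=> D0; rewrite triangleE// -[X in measurable X]setTI.
have mpq : measurable_fun setT (fun s : mR * mR => orient p q s / orient p q r : mR).
  apply: measurable_funM => //; apply: measurable_funB; apply: measurable_funM => //;
    exact: measurable_funB.
have mpr : measurable_fun setT (fun s : mR * mR => orient p s r / orient p q r : mR).
  apply: measurable_funM => //; apply: measurable_funB; apply: measurable_funM => //;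
    exact: measurable_funB.
apply: (@measurable_fun_pair _ _ _ _ _ _ _ _ mpr mpq) => //.
exact: measurable_unit_triangle.
Qed.

(** The area of the unit triangle stays a symbolic factor, since only ratios of areas matter. *)
Lemma area_triangle p q r : orient p q r != 0 ->
  plane_area (triangle p q r) = (`|orient p q r|%:E * plane_area unit_triangle)%E.
Proof.
(* The factorisation below divides by [q.1 - p.1]. If this vanishes, [r.1 - p.1] does not, and [q]
   and [r] are exchanged. *)
wlog pq : q r / q.1 != p.1.
  move=> W D0; have [pq|] := eqVneq q.1 p.1; last by move=> pq; exact: W.
  have [pr|pr] := eqVneq r.1 p.1.
    by move: D0; rewrite /orient pq pr !subrr mul0r mulr0 subrr eqxx.
  have D0' : orient p r q != 0 by rewrite orient_swap oppr_eq0.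
  have := W r q pr D0'.
  by rewrite (triangle_swap p r q) (orient_swap p q r) normrN.
move=> D0; set D := orient p q r.
have u0 : q.1 - p.1 != 0 by rewrite subr_eq0.
have mT := measurable_unit_triangle.
have a0 : (q.1 - p.1)^-1 != 0 by rewrite invr_eq0.
have a0' : (q.1 - p.1) / D != 0 by rewrite mulf_neq0// invr_eq0.
(* The map to barycentric coordinates is a composite of two maps, each changing one coordinate:
   first the ordinate becomes the coordinate at [r], then the abscissa becomes the one at [q]. The
   scale factors multiply to the inverse of [D]. *)
rewrite (plane_area_affine_x (- (r.1 - p.1) / (q.1 - p.1)) (- p.1 / (q.1 - p.1)) a0 mT).
rewrite (plane_area_affine_y (- (q.2 - p.2) / D)
   (((q.2 - p.2) * p.1 - (q.1 - p.1) * p.2) / D) a0'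
   (measurable_comp_affine_x _ _ _ mT)).
rewrite !muleA -!EFinM.
have -> : `|D| * `|(q.1 - p.1)^-1| * `|(q.1 - p.1) / D| = 1.
  rewrite -!normrM; have -> : D * (q.1 - p.1)^-1 * ((q.1 - p.1) / D) = 1 by field; apply/andP.
  by rewrite normr1.
rewrite mul1e (triangleE D0); congr (plane_area _); apply/seteqP.
have E s : ((q.1 - p.1)^-1 * s.1 +
   (- (r.1 - p.1) / (q.1 - p.1) * (- (q.2 - p.2) / D * s.1 +
      ((q.1 - p.1) / D * s.2 + ((q.2 - p.2) * p.1 - (q.1 - p.1) * p.2) / D)) +
    - p.1 / (q.1 - p.1)),
  - (q.2 - p.2) / D * s.1 +
  ((q.1 - p.1) / D * s.2 + ((q.2 - p.2) * p.1 - (q.1 - p.1) * p.2) / D)) =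
  (orient p s r / D, orient p q s / D).
  by move: D0; rewrite /D /orient => D0; congr pair; field => //; apply/andP.
by split => s /=; rewrite E.
Qed.

Lemma le_area_triangle p q r p' q' r' (d k : R) :
  orient p q r != 0 -> orient p' q' r' != 0 -> 0 <= k ->
  k * `|orient p q r| <= `|orient p' q' r'| ->
  (d%:E <= plane_area (triangle p q r))%E ->
  ((d * k)%:E <= plane_area (triangle p' q' r'))%E.
Proof.
move=> D0 D0' k0 kD; rewrite !area_triangle// => dD.
rewrite mulrC EFinM (le_trans (lee_wpmul2l _ dD))//.
by rewrite muleA -EFinM lee_wpmul2r// integral_ge0.
Qed.

Lemma hull_sub (V : finType) (pos : V -> R * R) (A B : {set V}) :
  A \subset B -> hull pos A `<=` hull pos B.
Proof.
move=> /fintype.subsetP AB s [l [l0 l1 ->]].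
have E (f : V -> R) : \sum_(v in B) (if v \in A then l v else 0) * f v =
    \sum_(v in A) l v * f v.
  rewrite [RHS]big_mkcond [LHS]big_mkcond; apply: eq_bigr => v _.
  by case: (boolP (v \in A)) => [vA|_]; [rewrite (AB _ vA)|rewrite mul0r if_same].
exists (fun v => if v \in A then l v else 0); split.
- by move=> v; case: ifP.
- rewrite -l1; have := E (fun=> 1).
  by under eq_bigr do rewrite mulr1; under [X in _ = X]eq_bigr do rewrite mulr1.
- by rewrite !E.
Qed.

Lemma hull_triangle (V : finType) (pos : V -> R * R) (x y z : V) :
  uniq [:: x; y; z] ->
  hull pos [set x; y; z]%SET = triangle (pos x) (pos y) (pos z).
Proof.
rewrite /= !inE !negb_or => /and3P[/andP[xy xz] yz _].
have E (f : V -> R) : \sum_(v in [set x; y; z]%SET) f v = f x + f y + f z.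
  have yz' : y \notin [set z]%SET by rewrite finset.in_set1.
  have xyz : x \notin [set y; z]%SET by rewrite finset.in_set2 negb_or xy.
  by rewrite -finset.setUA big_setU1//= big_setU1//= big_set1 addrA.
apply/seteqP; split => s.
  by move=> [l [l0 + ->]]; rewrite !E => l1; exists (l x), (l y), (l z).
move=> [a [b [c [a0 b0 c0 abc ->]]]].
exists (fun v => if v == x then a else if v == y then b else if v == z then c else 0).
have [yx zx zy] : [/\ y != x, z != x & z != y] by rewrite !(eq_sym z) eq_sym.
rewrite !E !eqxx (negbTE yx) (negbTE zx) (negbTE zy); split => // v.
by do !case: ifP.
Qed.

End Area.

(** * Geometry of the cones *)

Section Cones.
Context {R : realType}.
Implicit Types (p q : R * R).

Definition in_cone (alpha : R) (i : 'I_3) p q : Prop :=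
  exists2 theta, direction p q theta &
    central_direction i - alpha / 2 <= theta <= central_direction i + alpha / 2.

(** The difference of the sines is [2 cos((x + e) / 2) sin((x - e) / 2)], and both factors are
    nonnegative. *)
Lemma sin_ge_sin (e x : R) : 0 <= e -> e <= x <= pi - e -> sin e <= sin x.
Proof.
move=> e0 /andP[ex xe]; have pi0 := @pi_gt0 R.
have -> : sin x = sin ((x + e) / 2 + (x - e) / 2) by congr sin; field.
have -> : sin e = sin ((x + e) / 2 - (x - e) / 2) by congr sin; field.
rewrite sinB sinD.
have c0 : 0 <= cos ((x + e) / 2) by apply: cos_ge0_pihalf; apply/andP; split; lra.
have s0 : 0 <= sin ((x - e) / 2) by apply: sin_ge0_pi; apply/andP; split; lra.
have := mulr_ge0 c0 s0; lra.
Qed.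

(** Consecutive central directions differ by [2 pi / 3] modulo [2 pi], so the angle between the two
    directions lies in [[pi / 3 + e, pi - e]]. *)
Lemma sin_cones (e theta phi : R) (i : 'I_3) (alpha := pi / 3 - e) : 0 < e < pi / 3 ->
  central_direction i - alpha / 2 <= theta <= central_direction i + alpha / 2 ->
  central_direction (ordS i) - alpha / 2 <= phi
    <= central_direction (ordS i) + alpha / 2 ->
  sin e <= sin (theta - phi).
Proof.
move=> /andP[e0 e3] /andP[t1 t2] /andP[f1 f2]; rewrite /alpha in t1 t2 f1 f2.
case: i t1 t2 f1 f2 => [[|[|[|//]]] Hi]; rewrite /central_direction/= => t1 t2 f1 f2.
(* Only from the first colour to the second does the angle wrap around. *)
- rewrite -(sinD2pi (theta - phi)); apply: sin_ge_sin; first lra.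
  by rewrite -(mulr_natl pi); apply/andP; split; lra.
- by apply: sin_ge_sin; [lra|apply/andP; split; lra].
- by apply: sin_ge_sin; [lra|apply/andP; split; lra].
Qed.

Lemma ordS3 (i : 'I_3) : ordS (ordS (ordS i)) = i.
Proof. by apply/val_inj; case: i => [[|[|[|//]]] Hi]. Qed.

Lemma orient_cones (e : R) (i : 'I_3) (A B C t : R * R) (alpha := pi / 3 - e) :
  0 < e < pi / 3 ->
  in_cone alpha i t A -> in_cone alpha (ordS i) t B ->
  in_cone alpha (ordS (ordS i)) t C -> 0 < orient t C B /\
  (in_cone alpha i B A -> (1 + sin e ^+ 2) * orient t C B <= orient A C B).
Proof.
move=> e03 [ta [_ [a a0 ->]] ca] [tb [_ [b b0 ->]] cb] [tc [_ [c c0 ->]] cc].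
have [e0 e3] := andP e03.
have s0 : 0 < sin e by apply: sin_gt0_pi; apply/andP; split; lra.
have sab := sin_cones e03 ca cb; have sbc := sin_cones e03 cb cc.
have sca : sin e <= sin (tc - ta) by apply: (sin_cones e03 cc); rewrite ordS3.
have bc0 : 0 < b * c by exact: mulr_gt0.
have E : orient t (t.1 + c * cos tc, t.2 + c * sin tc)
    (t.1 + b * cos tb, t.2 + b * sin tb) = b * c * sin (tb - tc).
  by rewrite sinB /orient/=; ring.
rewrite E; split; first by rewrite mulr_gt0//; lra.
move=> [td [_ [d d0 [Ex Ey]]] cd]; have sdb := sin_cones e03 cd cb.
(* The triangle [ABC] is split at [t] into [tBC], [tAB] and [tAC]. *)
have -> : orient (t.1 + a * cos ta, t.2 + a * sin ta)
    (t.1 + c * cos tc, t.2 + c * sin tc) (t.1 + b * cos tb, t.2 + b * sin tb) =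
    b * c * sin (tb - tc) + a * b * sin (ta - tb) + a * c * sin (tc - ta).
  by rewrite !sinB /orient/=; ring.
(* Law of sines in [ABt]: cross product of [tA = tB + BA] with the direction of [BA]. *)
have sine : a * sin (td - ta) = b * sin (td - tb).
  rewrite !sinB; have -> : a * (sin td * cos ta - cos td * sin ta) =
    (a * cos ta) * sin td - (a * sin ta) * cos td by ring.
  have -> : a * cos ta = b * cos tb + d * cos td by lra.
  have -> : a * sin ta = b * sin tb + d * sin td by lra.
  by ring.
have ba : b * sin e <= a.
  rewrite (@le_trans _ _ (b * sin (td - tb)))//; first by rewrite ler_wpM2l// ltW.
  by rewrite -sine ler_piMr ?sin_le1// ltW.
(* [h1], [h2] and [h3] chain to bound [tAC] below by [sin e ^+ 2] times [tBC]; [h4] allows dropping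
   [tAB]. *)
have h1 : sin e ^+ 2 * (b * c * sin (tb - tc)) <= sin e * c * (b * sin e).
  rewrite (_ : _ * (b * c * _) = sin e * c * (b * sin e) * sin (tb - tc)); last ring.
  by rewrite ler_piMr ?sin_le1// !mulr_ge0// ltW.
have h2 : sin e * c * (b * sin e) <= sin e * c * a.
  by rewrite ler_wpM2l// mulr_ge0// ltW.
have h3 : sin e * c * a <= a * c * sin (tc - ta).
  rewrite (_ : _ * a = a * c * sin e); last ring.
  by rewrite ler_wpM2l// mulr_ge0// ltW.
have h4 : 0 <= a * b * sin (ta - tb).
  by rewrite !mulr_ge0// ?(ltW a0) ?(ltW b0)//; lra.
by rewrite mulrDl mul1r; lra.
Qed.

End Cones.

(** * Exponential decay of the nested triangles *)

Section Decay.
Context {R : realType}.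
Variables (m : nat) (a : 'I_3 -> strip m) (T : 'I_3 -> rel (strip m)).
Variables (pos : strip m -> R * R) (e : R).
Hypotheses (e03 : 0 < e < pi / 3) (wood : schnyder_wood a T).
Hypothesis drawing : schnyder_drawing (pi / 3 - e) a T pos.
Local Notation q k := (pos (strip_vertex m k)).

(* Positive since [k], [k + 1], [k + 2] are in clockwise order in the drawing. *)
Definition strip_det (k : nat) : R := orient (q k) (q k.+2) (q k.+1).

Lemma strip_cones : exists c : nat -> 'I_3, (forall j, c j.+1 = ordS (c j)) /\
  forall k j, (3 <= k < m.+3)%N -> (j < k <= j + 3)%N ->
    in_cone (pi / 3 - e) (c j) (q k) (q j).
Proof.
have [c [cS cT]] := wood_color wood; exists c; split => // k j kn jk.
have Tkj := cT k j kn jk; have [_ dir] := drawing.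
apply: dir Tkj; rewrite (internal_strip wood) strip_vertexE; by case/andP: kn.
Qed.

(** This is [orient_cones] with [k], [k + 1], [k + 2], [k + 3] as [A], [B], [C], [t]. The bound
    [2 <= k] makes [B] internal, so that its edge to [A] has the colour of [tA]. *)
Lemma strip_det_step (k : nat) : (k.+3 < m.+3)%N -> 0 < strip_det k.+1 /\
  ((2 <= k)%N -> (1 + sin e ^+ 2) * strip_det k.+1 <= strip_det k).
Proof.
move=> kn; have [c [cS cone]] := strip_cones.
have -> : strip_det k.+1 = orient (q k.+3) (q k.+2) (q k.+1).
  by rewrite /strip_det /orient; ring.
have [||| D0 H] := @orient_cones R e (c k) (q k) (q k.+1) (q k.+2) (q k.+3) e03.
- by apply: cone => //; rewrite addn3 leqnn andbT; do 2 apply: ltnW.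
- by rewrite -cS; apply: cone => //; rewrite addn3 ltnW //= leqW.
- by rewrite -!cS; apply: cone => //; rewrite addn3 ltnS leqnn /= ltnW // ltnW.
split => // k2; apply: H; apply: cone; rewrite ?ltnS ?k2 ?leqnn /=.
  by do 2 apply: ltnW.
by rewrite addn3; do 2 apply: leqW.
Qed.

Lemma strip_det_decay (j : nat) : (j + 4 < m.+3)%N ->
  (1 + sin e ^+ 2) ^+ j * strip_det (j + 2) <= strip_det 2.
Proof.
elim: j => [|j IH] jn; first by rewrite expr0 mul1r.
have jn' : (j + 4 < m.+3)%N by apply: leq_trans jn; rewrite !addnS ltnS leqnSn.
apply: le_trans (IH jn'); rewrite exprSr -mulrA ler_wpM2l//.
  by rewrite exprn_ge0// addr_ge0// sqr_ge0.
rewrite addSn; apply: (strip_det_step _).2; last by rewrite leq_addl.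
by move: jn; rewrite !addnS !addSn addn0.
Qed.

End Decay.

(** The left-hand side is [Q] to the power [(j + 6) / 6], and [j + 6 <= 6 (j + 1)]. *)
Lemma powR2_ln_le_exprn (R : realType) (Q : R) (j : nat) : 1 <= Q ->
  2 `^ (ln Q / (6 * ln 2) * j.+4.+2%:R) <= Q ^+ j.+1 :> R.
Proof.
move=> Q1; have l2 : 0 < ln 2 :> R by rewrite ln_gt0// ltr1n.
rewrite /powR pnatr_eq0/= -[X in _ <= X ^+ _]lnK; last by rewrite posrE; lra.
rewrite -expRM_natl ler_expR.
have -> : ln Q / (6 * ln 2) * j.+4.+2%:R * ln 2 = ln Q * (j.+4.+2%:R / 6) :> R.
  by field; rewrite gt_eqF.
rewrite mulrC ler_wpM2r ?ln_ge0//.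
rewrite ler_pdivrMr// -natrM ler_nat; lia.
Qed.

Theorem theorem3 (R : realType) :
  exists (F : emb_graph -> Prop) (D : nat),
    (forall G, F G -> planar_3tree G /\ forall v : G, (degree v <= D)%N) /\
    (forall N : nat, exists2 G, F G & (N <= #|G|)%N) /\
    forall eps : R, 0 < eps < pi / 3 ->
    exists2 c : R, 0 < c &
    forall (P : forall V : finType, rel V -> (V -> R * R) -> Prop) (delta : R),
      resolution_rule P delta ->
    forall G, F G ->
    forall (a : 'I_3 -> G) (T : 'I_3 -> rel G) (pos : G -> R * R),
      schnyder_wood a T ->
      schnyder_drawing (pi / 3 - eps) a T pos ->
      P G (@adj G) pos ->
      ((delta * 2 `^ (c * #|G|%:R))%:E <= area pos [set: G])%E.
Proof.
(* With six or more vertices there is at least one shrinking step, as needed for a bound exceeding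
   [delta]. *)
exists (fun G => exists m, G = strip m.+3), 7; split; [|split].
- by move=> _ [m ->]; split; [exact: strip_planar_3tree|exact: strip_degree].
- move=> N; exists (strip N.+3); first by exists N.
  by rewrite card_ord; lia.
move=> e e03; have [e0 e3] := andP e03; pose Q := 1 + sin e ^+ 2.
have s0 : 0 < sin e by apply: sin_gt0_pi; apply/andP; split; lra.
have Q1 : 1 < Q by rewrite ltrDl exprn_gt0.
exists (ln Q / (6 * ln 2)).
  by rewrite divr_gt0 ?ln_gt0// mulr_gt0// ln_gt0// ltr1n.
move=> P delta [delta0 rule] _ [m ->] a T pos wood drawing Ppos.
pose v := strip_vertex m.+3.
have D3 : 0 < strip_det pos m.+3.
  by have [] := strip_det_step e03 wood drawing (ltnSn m.+4.+1).
have D2 : 0 < strip_det pos 2.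
  by have [] := @strip_det_step _ _ _ _ _ _ e03 wood drawing 1 isT.
(* From the triangle [2, 3, 4] to that of the last three vertices there are [m + 1] steps, while the
   graph has [m + 6] vertices. *)
have DQ : Q ^+ m.+1 * strip_det pos m.+3 <= strip_det pos 2.
  have m4 : (m.+1 + 4 < m.+3.+3)%N by rewrite addnC.
  by have := strip_det_decay e03 wood drawing m4; rewrite addn2.
have tri k : (k.+2 < m.+3.+3)%N -> hull pos [set v k; v k.+2; v k.+1]%SET =
    triangle (pos (v k)) (pos (v k.+2)) (pos (v k.+1)).
  by move=> kn; apply: hull_triangle; rewrite /= !inE -!val_eqE /= !strip_vertexE; lia.
(* The resolution rule is applied to the innermost triangle as a subgraph. *)
have base : (delta%:E <= area pos [set v m.+3; v m.+4.+1; v m.+4]%SET)%E.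
  apply: (rule _ (@adj (strip m.+3)) pos drawing.1 Ppos _ (v m.+3) (v m.+4.+1) (v m.+4));
    rewrite ?finset.inE ?eqxx ?orbT//;
    rewrite /adj /= /strip_adj /near3 !strip_vertexE//; lia.
have sub : (hull pos [set v 2; v 4; v 3]%SET `<=` hull pos [set: strip m.+3]%SET)%classic.
  by apply: hull_sub; exact: finset.subsetT.
have m2 : measurable (hull pos [set v 2; v 4; v 3]%SET).
  by rewrite (tri 2 isT); apply: measurable_triangle; rewrite gt_eqF.
apply: (le_trans _ (le_plane_area m2 sub)).
rewrite (tri 2 isT); rewrite /area (tri m.+3 (ltnSn _)) in base.
have Dk : Q ^+ m.+1 * `|strip_det pos m.+3| <= `|strip_det pos 2|.
  by rewrite !gtr0_norm.
have Q0 : 0 <= Q ^+ m.+1 by rewrite exprn_ge0// ltW// (lt_trans _ Q1).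
apply: le_trans (le_area_triangle _ _ Q0 Dk base); try by rewrite gt_eqF.
by rewrite lee_fin ler_wpM2l ?(ltW delta0)// card_ord powR2_ln_le_exprn// ltW.
Qed.
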